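(* For every integer $l\ge 1$, $$\mathcal B_{l,3}=F_{l+3},$$ where $\mathcal B_{l,3}$ is the common value $\mathcal B^{(1)}_{l,3}=\mathcal B^{(2)}_{l,3}$ of the numbers of brick-wall lattice paths of the first and of the second type connecting the left and right sides of the rectangle $[0,l-1]\times[0,2]$.
   Context: The Fibonacci sequence is $F_0=0$, $F_1=1$, $F_n=F_{n-1}+F_{n-2}$ for $n\ge2$. A point $(a,b)\in\mathbf Z\times\mathbf Z$ is even (odd) if $|a|+|b|$ is even (odd). A brick-wall lattice path of the first type is a finite sequence of points of $\mathbf Z\times\mathbf Z$ in which each consecutive step is either the horizontal step $(1,0)$ (allowed from any point), or the step $(0,1)$ taken from an even point, or the step $(0,-1)$ taken from an odd point. A brick-wall lattice path of the second type is defined in the same way with the steps $(1,0)$ from any point, $(0,1)$ from an odd point, $(0,-1)$ from an even point. Paths visit no point more than once; the empty path (a single point) is allowed. Let $\mathcal R=[0,l-1]\times[0,w-1]$, here with $w=3$. For $t\in\{1,2\}$, $\mathcal B^{(t)}_{l,w}$ is the number of brick-wall lattice paths of type $t$ (type 1 = first, type 2 = second) starting at some point $(0,\alpha)$ and ending at some point $(l-1,\beta)$, with $\alpha,\beta\in\{0,\dots,w-1\}$, staying inside $\mathcal R$ and using no vertical step along the left side $x=0$ (vertical steps along the right side $x=l-1$ are allowed when $l\ge2$). For $l=1$ the rectangle is a degenerate vertical segment and only the $w$ empty paths are counted. *)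

(* Defs.v *)
From mathcomp Require Import all_boot all_order all_algebra.
From mathcomp Require Import finmap boolp classical_sets cardinality.

Set Implicit Arguments.
Unset Strict Implicit.
Unset Printing Implicit Defensive.

Import Order.TTheory GRing.Theory Num.Theory.
Local Open Scope ring_scope.

Fixpoint fib (n : nat) : nat :=
  match n with
  | 0 => 0
  | 1 => 1
  | (n'.+1 as m).+1 => (fib m + fib n')%N
  end.

Definition point : Type := (int * int)%type.

Definition odd_point (z : point) : bool := odd (`|z.1|%N + `|z.2|%N).
Definition even_point (z : point) : bool := ~~ odd_point z.

Inductive path_type : Set := First | Second.

Definition may_go_up (t : path_type) (z : point) : bool :=
  match t with First => even_point z | Second => odd_point z end.

Definition may_go_down (t : path_type) (z : point) : bool :=
  match t with First => odd_point z | Second => even_point z end.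

Definition brick_step (t : path_type) : rel (int * int) := fun z z' =>
  [|| z' == (z.1 + 1, z.2),
      may_go_up t z && (z' == (z.1, z.2 + 1)) |
      may_go_down t z && (z' == (z.1, z.2 - 1))].

(* A path is its sequence of visited points, so the empty path at z is
   [:: z], and the sequence [::] is not a path. *)
Definition brick_path (t : path_type) (p : seq (int * int)) : bool :=
  [&& p != [::], sorted (brick_step t) p & uniq p].

Definition in_rectangle (l w : nat) (z : point) : bool :=
  (0 <= z.1 <= l%:Z - 1) && (0 <= z.2 <= w%:Z - 1).

Definition no_left_vertical_step : rel (int * int) := fun z z' =>
  ~~ [&& z.1 == 0, z'.1 == 0 & z.2 != z'.2].

(* The left and right sides coincide for l = 1; no vertical step is then
   possible, and only the empty paths remain.  The heights of the two
   endpoints are constrained by in_rectangle. *)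
Definition connecting_path (t : path_type) (l w : nat)
    (p : seq (int * int)) : bool :=
  [&& brick_path t p,
      all (in_rectangle l w) p,
      sorted no_left_vertical_step p,
      (head (0, 0) p).1 == 0 &
      (last (0, 0) p).1 == l%:Z - 1].

(* fset_set sends an infinite set to the empty one; here the set is finite,
   being made of repetition-free sequences of points of a finite rectangle. *)
Definition brick_count (t : path_type) (l w : nat) : nat :=
  #|` fset_set [set p | connecting_path t l w p]%classic |%fset.

(* Main.v *)
(** A vertical edge of the brick wall is traversable in both directions, so
    every vertex has exactly one vertical neighbour, and a repetition-free path
    makes at most one vertical step in each column.  Counting the paths by
    columns from the left, a column of height 3 contains a single vertical edge,
    at the bottom or at the top in alternation; if [a] is the number of
    completions from either end of this edge and [c] that from the isolated
    vertex, then [(a, c)] becomes [(a + c, a)] with one more column. *)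
Require Import Defs.
From mathcomp Require Import all_boot all_order all_algebra.
From mathcomp Require Import finmap classical_sets cardinality zify.

Set Implicit Arguments.
Unset Strict Implicit.
Unset Printing Implicit Defensive.

Import Order.TTheory GRing.Theory Num.Theory.
Local Open Scope ring_scope.

(** * Steps and vertical edges of the brick wall *)

Definition right_of (z : int * int) : int * int := (z.1 + 1, z.2).

Definition vertical_neighbour (t : path_type) (z : int * int) : int * int :=
  if may_go_up t z then (z.1, z.2 + 1) else (z.1, z.2 - 1).

(** Only the height is tested: this suffices for a vertical neighbour, which stays in the column of
    its vertex. *)
Definition in_strip (w : nat) (z : int * int) : bool := 0 <= z.2 <= w%:Z - 1.

Lemma may_go_downE t z : may_go_down t z = ~~ may_go_up t z.
Proof. by case: t; rewrite /= /even_point ?negbK. Qed.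

Lemma brick_stepE t z z' :
  brick_step t z z' = (z' == right_of z) || (z' == vertical_neighbour t z).
Proof.
rewrite /brick_step may_go_downE /vertical_neighbour.
by case: (may_go_up t z); rewrite /= ?orbF.
Qed.

Lemma may_go_up_right t z : may_go_up t (right_of z) = ~~ may_go_up t z.
Proof.
case: z => x y; case: t; rewrite /right_of /= /even_point /odd_point /=; lia.
Qed.

Lemma may_go_up_above t x y : may_go_up t (x, y + 1) = ~~ may_go_up t (x, y).
Proof. case: t; rewrite /= /even_point /odd_point /=; lia. Qed.

Lemma may_go_up_below t x y : may_go_up t (x, y - 1) = ~~ may_go_up t (x, y).
Proof. by rewrite -[in RHS](subrK 1 y) may_go_up_above negbK. Qed.

Lemma vertical_neighbour1 t z : (vertical_neighbour t z).1 = z.1.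
Proof. by rewrite /vertical_neighbour; case: ifP. Qed.

Lemma vertical_neighbour2 t z : (vertical_neighbour t z).2 != z.2.
Proof. rewrite /vertical_neighbour; case: ifP => _ /=; lia. Qed.

(** The two ends of a vertical edge have opposite parities, so one allows the step up exactly when
    the other allows the step down. A second vertical step in a row therefore returns to the
    start. *)
Lemma vertical_neighbourK t : involutive (vertical_neighbour t).
Proof.
move=> [x y]; rewrite {2}/vertical_neighbour.
case: ifP => up; rewrite /vertical_neighbour.
  by rewrite may_go_up_above up /= addrK.
by rewrite may_go_up_below up /= subrK.
Qed.

Lemma right_of_neq_vertical t z :
  (right_of z == vertical_neighbour t z) = false.
Proof.
apply/negP => /eqP/(congr1 fst); rewrite vertical_neighbour1 /=; lia.
Qed.

Lemma brick_step_le t z z' : brick_step t z z' -> z.1 <= z'.1.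
Proof.
rewrite brick_stepE => /orP[]/eqP->; rewrite ?vertical_neighbour1 //=; lia.
Qed.

(** No step decreases the abscissa, so a column that has been left is never entered again;
    repetitions need to be excluded only within a column. *)
Lemma brick_path_ge t z s u :
  path (brick_step t) z s -> u \in s -> z.1 <= u.1.
Proof.
move=> /(sub_path (e' := fun a b => a.1 <= b.1)) => /(_ (@brick_step_le t)).
move=> /order_path_min-/(_ (fun a b c => @le_trans _ _ a.1 b.1 c.1)).
by move=> /allP; apply.
Qed.

(** * Completions of a path: enumeration and count *)

(* The points visited after [z] by the paths that enter a column at [z] and
   end in the [n]-th column to its right. *)
Fixpoint completions t (w n : nat) (z : int * int) : seq (seq (int * int)) :=
  let v := vertical_neighbour t z in
  match n with
  | 0 => [::] :: if in_strip w v then [:: [:: v]] else [::]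
  | n'.+1 =>
      [seq right_of z :: s | s <- completions t w n' (right_of z)] ++
      if in_strip w v
      then [seq v :: right_of v :: s | s <- completions t w n' (right_of v)]
      else [::]
  end.

Lemma completions_uniq t w n z : uniq (completions t w n z).
Proof.
elim: n z => [|n IHn] z /=; first by case: ifP.
rewrite cat_uniq map_inj_uniq ?IHn; last by move=> ? ? [].
case: ifP => //= _; rewrite map_inj_uniq ?IHn ?andbT; last by move=> ? ? [].
apply/hasPn => _ /mapP[s _ ->]; apply/negP => /mapP[s' _ [] /esym/eqP].
by rewrite right_of_neq_vertical.
Qed.

Lemma brick_path_uniq_right t z s :
  path (brick_step t) (right_of z) s ->
  uniq [:: z, right_of z & s] = uniq (right_of z :: s).
Proof.
move=> ps; rewrite [LHS]cons_uniq; case: (boolP (_ \in _)) => //=.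
rewrite inE => /orP[/eqP/(congr1 fst)/=|/(brick_path_ge ps) /=]; lia.
Qed.

Lemma brick_path_uniq_vertical t z (v := vertical_neighbour t z) s :
  path (brick_step t) (right_of v) s ->
  uniq [:: z, v, right_of v & s] = uniq (right_of v :: s).
Proof.
move=> ps; rewrite [LHS]cons_uniq (brick_path_uniq_right ps).
case: (boolP (_ \in _)) => //=.
have v1 : v.1 = z.1 by exact: vertical_neighbour1.
have v2 : v.2 != z.2 by exact: vertical_neighbour2.
rewrite !inE => /or3P[/eqP zv|/eqP/(congr1 fst)/=|/(brick_path_ge ps)/=].
- by rewrite zv eqxx in v2.
- lia.
- lia.
Qed.

(** This specifies the lists that [completions] should enumerate. The left side is not mentioned,
    because the condition on it concerns only the first step of a connecting path. *)
Definition completing t l w z s : bool :=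
  [&& path (brick_step t) z s, uniq (z :: s), all (in_rectangle l w) s
    & (last z s).1 == l%:Z - 1].

Lemma completing_right t l w z s :
  completing t l w z (right_of z :: s) =
  in_rectangle l w (right_of z) && completing t l w (right_of z) s.
Proof.
rewrite /completing [path _ _ _]/= [all _ _]/= [last _ _]/= brick_stepE eqxx /=.
case: (boolP (path _ _ _)) => [ps|]; last by rewrite andbF.
by have /= -> := brick_path_uniq_right ps; rewrite -!andbA; do !bool_congr.
Qed.

Lemma completing_vertical t l w z (v := vertical_neighbour t z) s :
  completing t l w z [:: v, right_of v & s] =
  in_rectangle l w v &&
    (in_rectangle l w (right_of v) && completing t l w (right_of v) s).
Proof.
rewrite /completing [path _ _ _]/= [all _ _]/= [last _ _]/= !brick_stepE !eqxx.
rewrite orbT /=; case: (boolP (path _ _ _)) => [ps|]; last by rewrite !andbF.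
by have /= -> := brick_path_uniq_vertical ps; rewrite -!andbA; do !bool_congr.
Qed.

Lemma mem_map_cons (T : eqType) (a b : T) (s : seq T) (L : seq (seq T)) :
  (a :: s \in [seq b :: s' | s' <- L]) = (a == b) && (s \in L).
Proof.
apply/mapP/andP => [[s' s'L [-> ->]] //|[/eqP-> sL]]; by exists s.
Qed.

Lemma mem_map_cons2 (T : eqType) (a b c d : T) (s : seq T) (L : seq (seq T)) :
  ([:: a, b & s] \in [seq [:: c, d & s'] | s' <- L]) =
  [&& a == c, b == d & s \in L].
Proof. by rewrite (map_comp (cons c) (cons d)) !mem_map_cons. Qed.

(** Induction on the number [n] of columns to the right of [z]. A completion either steps right at
    once, or crosses the vertical edge and then steps right; in the last column it stops instead of
    stepping right. *)
Lemma mem_completions t l w n z s :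
  in_rectangle l w z -> z.1 + n%:Z = l%:Z - 1 ->
  (s \in completions t w n z) = completing t l w z s.
Proof.
elim: n z s => [|n IHn] z s zR zl; set v := vertical_neighbour t z.
  have v1 : v.1 = z.1 by exact: vertical_neighbour1.
  have strip_v : in_strip w v = in_rectangle l w v.
    by move: zR; rewrite /in_strip /in_rectangle v1 => /andP[-> _].
  (* Here [z] is in the last column, so a step to the right leaves the rectangle. *)
  have outr x : x.1 = z.1 -> in_rectangle l w (right_of x) = false.
    by rewrite /in_rectangle /=; lia.
  rewrite /= inE -/v strip_v; case: s => [|u s].
    by rewrite /completing /=; lia.
  rewrite /= /completing /= brick_stepE.
  case: (eqVneq u (right_of z)) => [->|_ /=].
    rewrite outr // andbF /= andbF; case: ifP => // _.
    by rewrite inE eqseq_cons right_of_neq_vertical.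
  case: (eqVneq u v) => [->|/negPf uv] /=; last first.
    by case: ifP; rewrite // inE eqseq_cons uv.
  case: s => [|u' s] /=.
    have zv : (z == v) = false.
      by apply/eqP => /(congr1 snd)/esym/eqP; exact/negP/vertical_neighbour2.
    by rewrite v1 inE zv; case: ifP => // _; rewrite inE eqxx; lia.
  have -> : ([:: v, u' & s] \in
      (if in_rectangle l w v then [:: [:: v]] else [::])) = false
    by case: ifP => //; rewrite inE eqseq_cons andbF.
  (* After [v], the next point is outside the rectangle or is [z] again. *)
  rewrite brick_stepE /v vertical_neighbourK -/v.
  case: (eqVneq u' (right_of v)) => [->|_ /=]; first by rewrite outr // !andbF.
  by case: (eqVneq u' z) => [->|_] //=; rewrite !inE eqxx orbT andbF.
have v1 : v.1 = z.1 by exact: vertical_neighbour1.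
have strip_v : in_strip w v = in_rectangle l w v.
  by move: zR; rewrite /in_strip /in_rectangle v1 => /andP[-> _].
have inr x : x.1 = z.1 -> in_rectangle l w x -> in_rectangle l w (right_of x).
  by rewrite /in_rectangle /=; lia.
have IHr x s' : x.1 = z.1 -> in_rectangle l w x ->
    (s' \in completions t w n (right_of x)) = completing t l w (right_of x) s'.
  by move=> xz xR; rewrite IHn ?inr //= xz; lia.
rewrite /= mem_cat -/v strip_v.
have nilL (T : eqType) (S : seq (seq T)) (f : seq T -> T) (g : seq T -> seq T) :
  ([::] \in [seq f x :: g x | x <- S]) = false by apply/negP => /mapP[].
case: s => [|u s].
  by rewrite nilL; case: ifP => _; rewrite ?nilL ?in_nil /completing /=; lia.
rewrite mem_map_cons; case: (eqVneq u (right_of z)) => [->|ur /=].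
  rewrite completing_right IHr // inr //=.
  case: ifP => _; last by rewrite orbF.
  rewrite [X in _ || X](_ : _ = false) ?orbF //.
  by apply/negP => /mapP[? _ [/eqP]]; rewrite right_of_neq_vertical.
case: (eqVneq u v) => [->|uv]; last first.
  rewrite /completing /= brick_stepE (negPf ur) (negPf uv) /=.
  case: ifP => // _; apply/negP => /mapP[? _ [/eqP]]; by rewrite (negPf uv).
case: s => [|u' s].
  rewrite /completing /= v1 [z.1 == _](_ : _ = false) ?andbF; last by lia.
  by case: ifP => // _; apply/negP => /mapP[].
case: (eqVneq u' (right_of v)) => [->|u'r].
  rewrite completing_vertical; case: ifP => //= vR.
  by rewrite mem_map_cons2 !eqxx IHr // inr.
(* The only other step from [v] leads back to [z], against [uniq]. *)
rewrite /completing /= (brick_stepE _ v) /v vertical_neighbourK -/v (negPf u'r).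
case: ifP => _; rewrite ?mem_map_cons2 ?(negPf u'r) ?andbF.
all: by case: (eqVneq u' z) => [->|_]; rewrite /= ?inE ?eqxx ?orbT /= ?andbF.
Qed.

(** The middle vertex is always an end of the vertical edge; the parity of [(x, 0)] decides whether
    the other end is at height 0 or 2. Ends of the edge get [fib (n + 3)], the isolated vertex
    [fib (n + 2)]. *)
Lemma size_completions3 t n x :
  [/\ size (completions t 3 n (x, 0)) =
        (if may_go_up t (x, 0) then fib (n + 3) else fib (n + 2)),
      size (completions t 3 n (x, 1)) = fib (n + 3)
    & size (completions t 3 n (x, 2)) =
        (if may_go_up t (x, 0) then fib (n + 2) else fib (n + 3))].
Proof.
have up1 y : may_go_up t (y, 1) = ~~ may_go_up t (y, 0).
  by rewrite -(may_go_up_above t y 0).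
have up2 y : may_go_up t (y, 2) = may_go_up t (y, 0).
  by rewrite -[2]/(1 + 1 : int) may_go_up_above up1 negbK.
have v0 y : vertical_neighbour t (y, 0) =
    if may_go_up t (y, 0) then (y, 1) else (y, -1) by [].
have v1 y : vertical_neighbour t (y, 1) =
    if may_go_up t (y, 0) then (y, 0) else (y, 2).
  by rewrite /vertical_neighbour up1; case: (may_go_up t (y, 0)).
have v2 y : vertical_neighbour t (y, 2) =
    if may_go_up t (y, 0) then (y, 3) else (y, 1).
  by rewrite /vertical_neighbour up2; case: ifP.
have fib3 m : fib (m.+1 + 3) = (fib (m + 3) + fib (m + 2))%N.
  by rewrite addSn addn3 addn2.
have fib2 m : fib (m.+1 + 2) = fib (m + 3) by rewrite addSn addn3 addn2.
elim: n x => [|n IHn] x.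
  by rewrite /= v0 v1 v2; case: (may_go_up t (x, 0)).
have [h0 h1 h2] := IHn (x + 1).
(* The edge changes sides in the next column, so the isolated vertex leads to an end of the next
   edge, and one end of the present edge leads to the next isolated vertex. *)
have upr : may_go_up t (x + 1, 0) = ~~ may_go_up t (x, 0).
  exact: (may_go_up_right t (x, 0)).
rewrite fib3 fib2 /= v0 v1 v2; move: h0 h2; rewrite upr.
case: (may_go_up t (x, 0)) => /= h0 h2;
  rewrite !size_cat !size_map /right_of /= ?h0 h1 h2 //.
all: by split; lia.
Qed.

(** * Enumeration of the connecting paths *)

Lemma brick_count_size t l w (L : seq (seq (int * int))) :
  uniq L -> (forall p, (p \in L) = connecting_path t l w p) ->
  brick_count t l w = size L.
Proof.
move=> uL LE; rewrite /brick_count.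
(* Writing the set as that of a list also gives its finiteness, so [fset_set] does not take its
   default value. *)
have -> : [set p | connecting_path t l w p]%classic =
    [set` [fset p in L]%fset]%classic.
  by apply/seteqP; split=> p /=; rewrite inE LE.
by rewrite set_fsetK card_fseq undup_id.
Qed.

Definition left_side (w : nat) : seq (int * int) :=
  [seq (0, y%:Z) | y <- iota 0 w].

(** [l] is arbitrary because column 0 lies in every rectangle of positive length. *)
Lemma mem_left_side l w z :
  (z \in left_side w) = (z.1 == 0) && in_rectangle l.+1 w z.
Proof.
case: z => x y; apply/mapP/andP => [[k] |[/eqP/= x0]].
  by rewrite mem_iota add0n /in_rectangle => kw [-> ->] /=; split=> //; lia.
rewrite x0 /in_rectangle /= => yw; exists `|y|%N; last by congr (_, _); lia.
by rewrite mem_iota; lia.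
Qed.

Lemma left_side_uniq w : uniq (left_side w).
Proof. by rewrite map_inj_uniq ?iota_uniq // => i j []. Qed.

(** Here [n] stands for [l - 1]. The first step must go right, so completions start in column 1,
    where vertical steps are free; for [n = 0] there is no such column. *)
Definition connecting_paths t w n : seq (seq (int * int)) :=
  match n with
  | 0 => [seq [:: z] | z <- left_side w]
  | n'.+1 => [seq [:: z, right_of z & s] | z <- left_side w,
                s <- completions t w n' (right_of z)]
  end.

Lemma connecting_paths_uniq t w n : uniq (connecting_paths t w n).
Proof.
case: n => [|n] /=; first by rewrite map_inj_uniq ?left_side_uniq // => ? ? [].
apply: allpairs_uniq_dep => [|z _|];
  rewrite ?left_side_uniq ?completions_uniq //.
by move=> [z s] [z' s'] _ _ /= [-> _ _ ->].
Qed.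

Lemma brick_path_no_left t z s :
  path (brick_step t) z s -> 0 < z.1 -> path no_left_vertical_step z s.
Proof.
elim: s z => [//|u s IHs] z /= /andP[zu us] z0.
rewrite (IHs u us (lt_le_trans z0 (brick_step_le zu))) andbT.
by rewrite /no_left_vertical_step; lia.
Qed.

Lemma connecting_path1 t l w z :
  connecting_path t l w [:: z] = [&& z.1 == 0, in_rectangle l w z & l == 1].
Proof. rewrite /connecting_path /=; lia. Qed.

(** A vertical first step would lie on the left side. After a step right the abscissa stays
    positive, so [no_left_vertical_step] holds from there on. *)
Lemma connecting_path_cons2 t l w z z' s :
  connecting_path t l w [:: z, z' & s] =
  [&& z.1 == 0, in_rectangle l w z, z' == right_of z &
    completing t l w z (z' :: s)].
Proof.
rewrite /connecting_path /brick_path /completing.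
rewrite [sorted _ _]/= [sorted no_left_vertical_step _]/= [head _ _]/=.
rewrite [last (0, 0) _]/= [last z _]/= [all _ (z :: _)]/= [path _ z _]/=.
case: (eqVneq z.1 0) => [z0|]; last by rewrite !andbF.
case: (boolP (brick_step t z z')) => [|_]; last by rewrite !andbF.
rewrite brick_stepE => /orP[]/eqP->.
  case: (boolP (path (brick_step t) _ _)) => [ps|]; last by rewrite /= !andbF.
  rewrite (brick_path_no_left ps) /= ?z0 //.
  rewrite [no_left_vertical_step _ _](_ : _ = true); last first.
    by rewrite /no_left_vertical_step /= eqxx !andbF.
  by rewrite eqxx -!andbA; do !bool_congr.
rewrite [_ == right_of z]eq_sym right_of_neq_vertical andbF.
rewrite [no_left_vertical_step _ _](_ : _ = false) ?andbF //.
rewrite /no_left_vertical_step vertical_neighbour1 z0 eqxx /=.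
by rewrite eq_sym vertical_neighbour2.
Qed.

Lemma mem_connecting_paths t w n p :
  (p \in connecting_paths t w n) = connecting_path t n.+1 w p.
Proof.
case: n p => [|n] [|z [|z' s]] /=.
- by apply/mapP => -[].
- rewrite mem_map => [|? ? [] //].
  by rewrite (mem_left_side 0) connecting_path1 andbT.
- rewrite connecting_path_cons2; case: (eqVneq z' _) => [->|_]; last first.
    by rewrite /= !andbF; apply/mapP => -[].
  rewrite completing_right; apply/mapP/idP => [[] //|/and5P[/eqP z0 _ _]].
  by rewrite /in_rectangle /= z0.
- by apply/allpairsPdep => -[? [? []]].
- by rewrite connecting_path1 !andbF; apply/allpairsPdep => -[? [? []]].
rewrite connecting_path_cons2 andbA -mem_left_side.
case: (boolP (z \in _)) => zl /=; last first.
  by apply/allpairsPdep => -[u [? [ul _ [zu _ _]]]]; rewrite zu ul in zl.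
move: (zl); rewrite (mem_left_side n.+1) => /andP[/eqP z0 zR].
have rR : in_rectangle n.+2 w (right_of z).
  by move: zR; rewrite /in_rectangle /= z0; lia.
have mc s' : (s' \in completions t w n (right_of z)) =
    completing t n.+2 w (right_of z) s'.
  by apply: mem_completions => //=; rewrite z0; lia.
case: (eqVneq z' (right_of z)) => [->|z'r] /=; last first.
  apply/allpairsPdep => -[u [? [_ _ [zu z'u _]]]].
  by rewrite z'u zu eqxx in z'r.
rewrite completing_right rR -mc /=.
apply/allpairsPdep/idP => [[u [s' [_ us' [-> _ _ ->]]]] //|sc].
by exists z, s.
Qed.

Theorem corollary3p2 (l : nat) (hl : (1 <= l)%N) :
  brick_count First l 3 = fib (l + 3)%N /\
  brick_count Second l 3 = fib (l + 3)%N.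
Proof.
suff count t : brick_count t l 3 = fib (l + 3)%N by split.
case: l hl => // n _.
rewrite (brick_count_size (connecting_paths_uniq t 3 n)); last first.
  exact: mem_connecting_paths.
case: n => [//|n].
rewrite size_allpairs_dep /= /right_of add0r /=.
(* With [l = n + 2], column 1 has two ends of an edge and one isolated vertex, for either parity:
   twice [fib (n + 3)] plus [fib (n + 2)] is [fib (n + 5)]. *)
have [-> -> ->] := size_completions3 t n 1.
case: (may_go_up t (1, 0)) => /=; rewrite !addn3 !addn2 /=; lia.
Qed.
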